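(* Let $k\ge1$ be an integer. There exists an almost law $(w_n)_n$ for ${\rm SU}(k)$ for which there is a constant $C>0$ such that, for all $n$, $$L_k(w_n)\le\exp\left(-C\cdot\ell(w_n)^{\delta}\right)\qquad\text{with}\qquad\delta=\frac{\log_2(1+\sqrt2)}{\log_2(3+\sqrt{17})-1}.$$
   Context: $\mathbb{F}_2$ is the free group on generators $a,b$, with word length $\ell$ with respect to $\{a,a^{-1},b,b^{-1}\}$. For a group $G$, each $w\in\mathbb{F}_2$ gives a word map $w\colon G\times G\to G$, $(g,h)\mapsto w(g,h)$, by evaluating $a\mapsto g$, $b\mapsto h$. An almost law for a compact group $G$ is a sequence $(w_n)_n$ of non-trivial elements of $\mathbb{F}_2$ such that for every neighborhood $V\subset G$ of the neutral element there is $m\in\mathbb{N}$ with $w_n(G\times G)\subset V$ for all $n\ge m$. On ${\rm SU}(k)$ use the metric $d(u,v)=\|u-v\|$ with $\|\cdot\|$ the operator norm, and put $L_k(w):=\max\{d(1_k,w(u,v)) : u,v\in{\rm SU}(k)\}$, where $1_k$ is the identity matrix. *)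

(* Defs.v *)
From HB Require Import structures.
From mathcomp Require Import all_boot all_order all_algebra.
From mathcomp Require Import all_classical all_reals all_analysis.
From mathcomp Require Import complex.
Set Implicit Arguments.
Unset Strict Implicit.
Unset Printing Implicit Defensive.
Import Order.TTheory GRing.Theory Num.Theory.
Import numFieldNormedType.Exports.
Local Open Scope classical_set_scope.
Local Open Scope ring_scope.
Local Open Scope complex_scope.

(* [(s, e)] encodes the letter a (if [s = false]) or b (if [s = true]),
   inverted when [e = true]. *)
Definition letter : Type := (bool * bool)%type.
HB.instance Definition _ := Countable.on letter.

Definition letter_inv (x : letter) : letter := (x.1, ~~ x.2).

Definition reduced (s : seq letter) : bool :=
  sorted [rel x y | y != letter_inv x] s.

Record F2 : Type := FreeWord { F2_word :> seq letter; _ : reduced F2_word }.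
HB.instance Definition _ := [isSub for F2_word].
HB.instance Definition _ := [Countable of F2 by <:].

(* Left multiplication by a letter, with cancellation. *)
Definition push (x : letter) (s : seq letter) : seq letter :=
  if s is y :: s' then if y == letter_inv x then s' else x :: s else [:: x].

Lemma letter_invK : involutive letter_inv.
Proof. by case=> s e; rewrite /letter_inv /= negbK. Qed.

Arguments letter_inv : simpl never.

Lemma push_reduced x s : reduced s -> reduced (push x s).
Proof.
rewrite /reduced; case: s => [//|y s] /= ys.
by case: ifPn => [_|yx] /=; [exact: path_sorted ys|rewrite yx].
Qed.

Lemma foldr_push_reduced s t : reduced t -> reduced (foldr push t s).
Proof. by move=> rt; elim: s => //= x s; apply: push_reduced. Qed.

Lemma push_invK x s : reduced s -> push x (push (letter_inv x) s) = s.
Proof.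
case: s => [|y s] /=; first by rewrite eqxx.
rewrite letter_invK; case: eqP => [->|_] /=; last by rewrite eqxx.
by case: s => [//|z s] /= /andP[/negbTE ->].
Qed.

Lemma foldr_push_push x s t : reduced s -> reduced t ->
  foldr push t (push x s) = push x (foldr push t s).
Proof.
case: s => [//|y s] rs rt /=; case: eqP => [->|//] /=.
by rewrite push_invK// foldr_push_reduced.
Qed.

Lemma foldr_push_nil s : reduced s -> foldr push [::] s = s.
Proof.
elim: s => //= x s IH xs; rewrite IH; last exact: path_sorted xs.
by case: s xs {IH} => //= y s /andP[/negbTE ->].
Qed.

Lemma foldr_pushA s t u : reduced t -> reduced u ->
  foldr push (foldr push u t) s = foldr push u (foldr push t s).
Proof.
move=> rt ru; elim: s => //= x s ->.
by rewrite foldr_push_push// foldr_push_reduced.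
Qed.

Definition seq_inv (s : seq letter) := rev (map letter_inv s).

Lemma seq_invK : involutive seq_inv.
Proof.
by move=> s; rewrite /seq_inv map_rev revK -map_comp map_id_in// => x _ /=;
  exact: letter_invK.
Qed.

Lemma seq_inv_reduced s : reduced s -> reduced (seq_inv s).
Proof.
rewrite /reduced /seq_inv rev_sorted sorted_map; apply: sub_sorted => x y.
by rewrite /relpre /= letter_invK eq_sym.
Qed.

Lemma foldr_push_inv s : reduced s -> foldr push s (seq_inv s) = [::].
Proof.
rewrite /seq_inv; elim: s => //= x s IH xs.
rewrite rev_cons foldr_rcons /= letter_invK eqxx IH//; exact: path_sorted xs.
Qed.

Definition F2_one : F2 := @FreeWord [::] isT.
Definition F2_mul (u v : F2) : F2 :=
  FreeWord (foldr_push_reduced u (valP v)).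
Definition F2_inv (u : F2) : F2 := FreeWord (seq_inv_reduced (valP u)).

Fact F2_mulA : associative F2_mul.
Proof.
by move=> u v w; apply/val_inj; rewrite /= foldr_pushA; [|exact: valP..].
Qed.
Fact F2_mul1 : left_id F2_one F2_mul.
Proof. by move=> u; apply/val_inj. Qed.
Fact F2_mulr1 : right_id F2_one F2_mul.
Proof. by move=> u; apply/val_inj/foldr_push_nil/valP. Qed.
Fact F2_mulV : left_inverse F2_one F2_inv F2_mul.
Proof. by move=> u; apply/val_inj/foldr_push_inv/valP. Qed.
Fact F2_mulrV : right_inverse F2_one F2_inv F2_mul.
Proof.
move=> u; have := F2_mulV (F2_inv u).
by congr (_ = _); congr F2_mul; apply/val_inj; rewrite /= seq_invK.
Qed.
HB.instance Definition _ :=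
  isGroup.Build F2 F2_mulA F2_mul1 F2_mulr1 F2_mulV F2_mulrV.

(* Reduced words realize the minimal length over {a, a^-1, b, b^-1}. *)
Definition word_length (w : F2) : nat := size w.

Definition eval_letter (G : groupType) (g h : G) (x : letter) : G :=
  let y := if x.1 then h else g in if x.2 then (y^-1)%g else y.

Definition word_map (G : groupType) (w : F2) (g h : G) : G :=
  (\prod_(x <- w) eval_letter g h x)%g.

HB.mixin Record isTopologicalGroup G of Topological G & Group G := {
  mulg_continuous : continuous (fun x : G * G => (x.1 * x.2)%g) ;
  invg_continuous : continuous (fun x : G => (x^-1)%g) }.

#[short(type="topologicalGroupType")]
HB.structure Definition TopologicalGroup :=
  {G of isTopologicalGroup G & Topological G & Group G}.

Definition almost_law (G : topologicalGroupType) (w : nat -> F2) : Prop :=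
  (forall n, w n <> 1%g) /\
  (forall V : set G, nbhs (1%g : G) V ->
     exists m : nat, forall n : nat, (m <= n)%N ->
       forall g h : G, V (word_map (w n) g h)).

(* The usual topology of the complex numbers, given by the modulus. *)
HB.instance Definition _ (R : realType) := NormedModule.copy R[i] R[i]^o.

Record SU (R : realType) (k : nat) : Type := MkSU {
  SU_mx :> 'M[R[i]]_k ;
  _ : (SU_mx \is unitarymx) && (\det SU_mx == 1) }.
HB.instance Definition _ R k := [isSub for @SU_mx R k].
HB.instance Definition _ R k := [Choice of SU R k by <:].

Section SUGroup.
Variables (R : realType) (k : nat).
Local Notation SU := (SU R k).
Local Notation conj_trmx A := (map_mx Num.conj A^T).

Lemma SU_unitary (A : SU) : (A : 'M[R[i]]_k) \is unitarymx.
Proof. by case/andP: (valP A). Qed.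

Lemma SU_det (A : SU) : \det (A : 'M[R[i]]_k) = 1.
Proof. by case/andP: (valP A) => _ /eqP. Qed.

Fact SU_one_subproof :
  ((1%:M : 'M[R[i]]_k) \is unitarymx) && (\det (1%:M : 'M[R[i]]_k) == 1).
Proof.
by rewrite det1 eqxx andbT; apply/unitarymxP; rewrite mul1mx trmx1 map_mx1.
Qed.

Fact SU_mul_subproof (A B : SU) :
  ((A *m B : 'M[R[i]]_k) \is unitarymx) && (\det (A *m B : 'M[R[i]]_k) == 1).
Proof. by rewrite mul_unitarymx ?SU_unitary// det_mulmx !SU_det mulr1 eqxx. Qed.

Fact SU_inv_subproof (A : SU) :
  (conj_trmx A \is unitarymx) && (\det (conj_trmx A) == 1).
Proof.
by rewrite trmxC_unitary SU_unitary det_map_mx det_tr SU_det rmorph1 eqxx.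
Qed.

Definition SU_one : SU := MkSU SU_one_subproof.
Definition SU_mul (A B : SU) : SU := MkSU (SU_mul_subproof A B).
Definition SU_inv (A : SU) : SU := MkSU (SU_inv_subproof A).

Fact SU_mulA : associative SU_mul.
Proof. by move=> A B C; apply/val_inj; rewrite /= mulmxA. Qed.
Fact SU_mul1 : left_id SU_one SU_mul.
Proof. by move=> A; apply/val_inj; rewrite /= mul1mx. Qed.
Fact SU_mulr1 : right_id SU_one SU_mul.
Proof. by move=> A; apply/val_inj; rewrite /= mulmx1. Qed.
Fact SU_mulrV : right_inverse SU_one SU_inv SU_mul.
Proof. by move=> A; apply/val_inj/unitarymxP/SU_unitary. Qed.
Fact SU_mulV : left_inverse SU_one SU_inv SU_mul.
Proof. by move=> A; apply/val_inj/mulmx1C/unitarymxP/SU_unitary. Qed.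
HB.instance Definition _ :=
  isGroup.Build SU SU_mulA SU_mul1 SU_mulr1 SU_mulV SU_mulrV.

HB.instance Definition _ := Topological.copy SU (initial_topology (@SU_mx R k)).

Lemma SU_continuous (T : topologicalType) (f : T -> SU) :
  (forall i j, continuous (fun x => (f x : 'M[R[i]]_k) i j)) -> continuous f.
Proof.
move=> cf; apply/continuousP => _ [B Bo <-].
rewrite -[X in open X]/((@SU_mx R k \o f) @^-1` B).
move: B Bo; apply/continuousP => x U /= [P P_x PU].
suff : \forall y \near x, forall i j, P i j ((f y : 'M[R[i]]_k) i j).
  by apply: filterS => y Py; exact: PU.
by apply: filter_forall => i; apply: filter_forall => j; exact/cf/P_x.
Qed.

Lemma SU_coord_continuous i j : continuous (fun A : SU => (A : 'M[R[i]]_k) i j).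
Proof.
move=> A; apply: (@continuous_comp SU 'M[R[i]]_k R[i] _ (fun M => M i j)).
  exact: initial_continuous.
exact: coord_continuous.
Qed.

Lemma SU_mul_continuous : continuous (fun p : SU * SU => SU_mul p.1 p.2).
Proof.
apply: SU_continuous => i j; under eq_fun do rewrite /= mxE.
apply: continuous_big => [|l _ p]; first exact: add_continuous.
apply: cvgM.
  apply: (continuous_comp (f := fst) (g := fun A : SU => (A : 'M[R[i]]_k) i l)).
    exact: cvg_fst.
  exact: SU_coord_continuous.
apply: (continuous_comp (f := snd) (g := fun A : SU => (A : 'M[R[i]]_k) l j)).
  exact: cvg_snd.
exact: SU_coord_continuous.
Qed.

Lemma conjC_continuous : continuous (Num.conj : R[i] -> R[i]).
Proof.
move=> x U /nbhs_ballP[e e0 eU]; apply/nbhs_ballP; exists e => // y.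
by move=> xy; apply: eU; move: xy; rewrite -ball_normE /= -rmorphB norm_conjC.
Qed.

Lemma SU_inv_continuous : continuous SU_inv.
Proof.
apply: SU_continuous => i j A; under eq_fun do rewrite /= !mxE.
apply: (continuous_comp (f := fun A : SU => (A : 'M[R[i]]_k) j i)).
  exact: SU_coord_continuous.
exact: conjC_continuous.
Qed.

HB.instance Definition _ :=
  isTopologicalGroup.Build SU SU_mul_continuous SU_inv_continuous.

End SUGroup.

Definition l2norm (R : realType) (k : nat) (v : 'cV[R[i]]_k) : R :=
  Num.sqrt (\sum_i (complex.Re (v i 0) ^+ 2 + complex.Im (v i 0) ^+ 2)).

Definition opnorm (R : realType) (k : nat) (A : 'M[R[i]]_k) : R :=
  sup [set l2norm (A *m v) | v in [set v | l2norm v <= 1]].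

Definition SU_dist (R : realType) (k : nat) (u v : SU R k) : R :=
  opnorm ((u : 'M[R[i]]_k) - (v : 'M[R[i]]_k)).

(* The supremum is a maximum, as SU(k) is compact. *)
Definition L (R : realType) (k : nat) (w : F2) : R :=
  sup [set SU_dist 1%g (word_map w uv.1 uv.2) | uv in [set: SU R k * SU R k]].

Definition log2 (R : realType) (x : R) : R := ln x / ln 2.

Definition delta (R : realType) : R :=
  log2 (1 + Num.sqrt 2) / (log2 (3 + Num.sqrt 17) - 1).

(* Main.v *)
Require Import Defs.
From mathcomp Require Import all_boot all_order all_algebra.
From mathcomp Require Import all_classical all_reals all_analysis.
From mathcomp Require Import complex ring lra zify.
Import Order.TTheory GRing.Theory Num.Theory.
Import numFieldNormedType.Exports.
Local Open Scope ring_scope.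

(** Put [x_(n+1) = x_n^-1 x_(n-1) x_n x_(n-1)^-1].  A commutator of unitaries
at distances [c] and [d] from the identity is at distance at most [2 c d], so
[2 |x_n - 1|] decays like [exp (- c phi^n)] with [phi] the golden ratio, once
[x_0] and [x_1] are uniformly close to the identity.  Moreover
[x_n = x_(n-1)^-1 u_n] with [u_(n+1) = u_n x_(n-1)^-1], so one factor cancels
and the length grows at most like [2^n].  This gives the exponent
[log2 phi], slightly larger than [delta].

Starting words: by pigeonhole there is [N] such that each [g] has a power
[g^m], [0 < m <= N], close to the identity.  Commutators of conjugates of
[a, a^2, ..., a^N] then form one word which is close to the identity
everywhere.  Nontriviality is controlled by the first and last letters, which
also follow a pattern of period 3 along the recursion. *)

(** * The Euclidean norm on complex column vectors *)

Section EuclideanNorm.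
Context {R : realType} {k : nat}.
Implicit Types (u v : 'cV[R[i]]_k) (A B : 'M[R[i]]_k).

Definition sqnorm v : R :=
  \sum_i (complex.Re (v i 0) ^+ 2 + complex.Im (v i 0) ^+ 2).

Lemma sqnorm_ge0 v : 0 <= sqnorm v.
Proof. by apply: sumr_ge0 => i _; rewrite addr_ge0 ?sqr_ge0. Qed.

Lemma l2norm_ge0 v : 0 <= l2norm v. Proof. exact: sqrtr_ge0. Qed.

Lemma sqr_l2norm v : l2norm v ^+ 2 = sqnorm v.
Proof. by rewrite sqr_sqrtr// sqnorm_ge0. Qed.

Lemma l2norm0 : l2norm (0 : 'cV[R[i]]_k) = 0.
Proof.
rewrite /l2norm big1 ?sqrtr0// => i _.
by rewrite mxE /= !expr0n /= addr0.
Qed.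

Lemma l2norm_eq0 v : l2norm v = 0 -> v = 0.
Proof.
move=> v0; have : sqnorm v = 0 by rewrite -sqr_l2norm v0 expr0n.
move=> /psumr_eq0P v00; apply/matrixP => i j; rewrite mxE ord1.
have /eqP := v00 (fun i _ => addr_ge0 (sqr_ge0 _) (sqr_ge0 _)) i isT.
rewrite paddr_eq0 ?sqr_ge0// !sqrf_eq0.
by case: (v i 0) => a b /= /andP[/eqP-> /eqP->].
Qed.

(** Instead of Cauchy-Schwarz, the weighted inequality [(x + y)^2 <= (1 + t/s) x^2 + (1 + s/t) y^2]
    is summed over all coordinates with [s] and [t] the two norms; the total is exactly [(s + t)^2].
    Zero norms are split off first because the weights divide by them. *)
Lemma ler_l2normD u v : l2norm (u + v) <= l2norm u + l2norm v.
Proof.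
have [u0|u0] := eqVneq (l2norm u) 0.
  by rewrite (l2norm_eq0 _ u0) add0r l2norm0 add0r.
have [v0|v0] := eqVneq (l2norm v) 0.
  by rewrite (l2norm_eq0 _ v0) addr0 l2norm0 addr0.
have {u0}su : 0 < l2norm u by rewrite lt_def u0 l2norm_ge0.
have {v0}sv : 0 < l2norm v by rewrite lt_def v0 l2norm_ge0.
set s := l2norm u in su *; set t := l2norm v in sv *.
rewrite -(@ler_pXn2r _ 2) ?nnegrE ?addr_ge0 ?l2norm_ge0// sqr_l2norm.
have -> : (s + t) ^+ 2 = (1 + t / s) * s ^+ 2 + (1 + s / t) * t ^+ 2.
  by field; rewrite !gt_eqF.
rewrite {2}/s {3}/t !sqr_l2norm /sqnorm !mulr_sumr -big_split/=.
apply: ler_sum => i _.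
rewrite mxE; case: (u i 0) => a b; case: (v i 0) => c d /=.
have sq x y : (x + y) ^+ 2 <= (1 + t / s) * x ^+ 2 + (1 + s / t) * y ^+ 2.
  rewrite -subr_ge0; suff -> : (1 + t / s) * x ^+ 2 + (1 + s / t) * y ^+ 2 -
    (x + y) ^+ 2 = (t * x - s * y) ^+ 2 / (s * t).
    by rewrite divr_ge0 ?sqr_ge0// ltW// mulr_gt0.
  by field; rewrite !gt_eqF.
have := sq a c; have := sq b d; lra.
Qed.

Lemma l2normZ (z : R[i]) v :
  l2norm (z *: v) = Num.sqrt (complex.Re z ^+ 2 + complex.Im z ^+ 2) * l2norm v.
Proof.
rewrite /l2norm -sqrtrM ?addr_ge0 ?sqr_ge0// mulr_sumr.
congr Num.sqrt; apply: eq_bigr => i _; rewrite mxE.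
by case: z => a b; case: (v i 0) => c d /=; ring.
Qed.

Lemma l2normN v : l2norm (- v) = l2norm v.
Proof.
rewrite -scaleN1r l2normZ/= oppr0 expr0n addr0 sqrrN expr1n.
by rewrite sqrtr1 mul1r.
Qed.

Lemma l2norm_unitary A v : A \is unitarymx -> l2norm (A *m v) = l2norm v.
Proof.
have normE w : ((sqnorm w)%:C)%C = ((map_mx Num.conj w^T) *m w) 0 0.
  rewrite mxE rmorph_sum/=; apply: eq_bigr => i _; rewrite !mxE.
  case: (w i 0) => a b /=; apply/eqP; rewrite eq_complex/=.
  by apply/andP; split; apply/eqP; ring.
move=> Au; congr Num.sqrt; apply: complexI.
rewrite -!/(sqnorm _) !normE trmx_mul map_mxM -mulmxA (mulmxA _ A).
by move/unitarymxP/mulmx1C : Au => ->; rewrite mul1mx.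
Qed.

Lemma mulmx_col_sum A v : A *m v = \sum_j v j 0 *: col j A.
Proof.
apply/matrixP => i j; rewrite ord1 mxE summxE; apply: eq_bigr => l _.
by rewrite !mxE mulrC.
Qed.

End EuclideanNorm.

(** * Upper bounds on operator norms *)

Section OperatorBound.
Context {R : realType} {k : nat}.
Implicit Types (v : 'cV[R[i]]_k) (A B U : 'M[R[i]]_k) (c d : R).

(** Bounds are carried by this predicate and turned into a bound on the supremum [opnorm] only at
    the end, by [opnorm_le]; sums and products then need no facts about suprema. *)
Definition opbound A c := forall v, l2norm (A *m v) <= c * l2norm v.

Lemma opbound_le A c d : c <= d -> opbound A c -> opbound A d.
Proof. by move=> cd Ac v; rewrite (le_trans (Ac v))// ler_wpM2r ?l2norm_ge0. Qed.

Lemma opboundD A B c d : opbound A c -> opbound B d -> opbound (A + B) (c + d).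
Proof.
by move=> Ac Bd v; rewrite mulmxDl mulrDl (le_trans (ler_l2normD _ _))// lerD.
Qed.

Lemma opboundN A c : opbound A c -> opbound (- A) c.
Proof. by move=> Ac v; rewrite mulNmx l2normN. Qed.

Lemma opboundM A B c d : 0 <= c -> opbound A c -> opbound B d ->
  opbound (A *m B) (c * d).
Proof.
by move=> c0 Ac Bd v; rewrite -mulmxA (le_trans (Ac _))// -mulrA ler_wpM2l.
Qed.

Lemma opbound_unitaryl U A c : U \is unitarymx -> opbound A c ->
  opbound (U *m A) c.
Proof. by move=> Uu Ac v; rewrite -mulmxA l2norm_unitary. Qed.

Lemma opbound_unitaryr U A c : U \is unitarymx -> opbound A c ->
  opbound (A *m U) c.
Proof.
by move=> Uu Ac v; rewrite -mulmxA (le_trans (Ac _))// l2norm_unitary.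
Qed.

Lemma opnorm_le A c : 0 <= c -> opbound A c -> opnorm A <= c.
Proof.
move=> c0 Ac; apply: ge_sup.
  by exists (l2norm (A *m 0)), 0 => //=; rewrite l2norm0.
by move=> _ [v /= v1 <-]; rewrite (le_trans (Ac v))// ler_piMr.
Qed.

Lemma opbound_entry A c i j : opbound A c ->
  complex.Re (A i j) ^+ 2 + complex.Im (A i j) ^+ 2 <= c ^+ 2.
Proof.
move=> /(_ (delta_mx j 0)); rewrite -colE.
have -> : l2norm (delta_mx j 0 : 'cV[R[i]]_k) = 1.
  rewrite /l2norm (bigD1 j)//= big1 ?addr0.
    by rewrite !mxE !eqxx/= expr1n expr0n addr0 sqrtr1.
  by move=> l lj; rewrite !mxE (negbTE lj)/= expr0n addr0.
rewrite mulr1 => Ac; rewrite (@le_trans _ _ (l2norm (col j A) ^+ 2))//.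
  rewrite sqr_l2norm /sqnorm (bigD1 i)//= mxE lerDl.
  by apply: sumr_ge0 => l _; rewrite addr_ge0 ?sqr_ge0.
by rewrite lerXn2r ?nnegrE ?l2norm_ge0// (le_trans (l2norm_ge0 _) Ac).
Qed.

(** A crude bound suffices: each column has norm at most [2 * c * k], and [A *m v] combines the [k]
    columns with coefficients of modulus at most [l2norm v]. *)
Lemma opbound_entries A c : 0 <= c ->
  (forall i j, `|complex.Re (A i j)| <= c /\ `|complex.Im (A i j)| <= c) ->
  opbound A (2 * c * k%:R ^+ 2).
Proof.
move=> c0 Ac v; rewrite mulmx_col_sum.
have colA j : l2norm (col j A) <= 2 * c * k%:R.
  rewrite -(@ler_pXn2r _ 2) ?nnegrE ?l2norm_ge0 ?mulr_ge0// sqr_l2norm.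
  apply: (@le_trans _ _ (\sum_(l < k) (2 * c ^+ 2))).
    apply: ler_sum => l _; rewrite !mxE mulr2n mulrDl mul1r.
    rewrite -[complex.Re _ ^+ 2]real_normK ?num_real//.
    rewrite -[complex.Im _ ^+ 2]real_normK ?num_real//.
    by have [? ?] := Ac l j; rewrite lerD// lerXn2r.
  rewrite sumr_const card_ord -[_ *+ k]mulr_natr.
  have kk : k%:R <= k%:R ^+ 2 :> R.
    by rewrite -natrX ler_nat -mulnn; case: (k) => // n; rewrite leq_pmulr.
  have := sqr_ge0 c; nra.
have vj j : Num.sqrt (complex.Re (v j 0) ^+ 2 + complex.Im (v j 0) ^+ 2) <= l2norm v.
  rewrite ler_wsqrtr// (bigD1 j)//= lerDl.
  by apply: sumr_ge0 => l _; rewrite addr_ge0 ?sqr_ge0.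
apply: (@le_trans _ _ (\sum_(j < k) (l2norm v * (2 * c * k%:R)))).
  elim/big_ind2 : _ => [|x1 x2 y1 y2 h1 h2|j _]; first by rewrite l2norm0.
    by rewrite (le_trans (ler_l2normD _ _))// lerD.
  by rewrite l2normZ ler_pM ?sqrtr_ge0 ?l2norm_ge0.
by rewrite sumr_const card_ord -[_ *+ k]mulr_natr; lra.
Qed.

End OperatorBound.

(** * Distance to the identity under the group operations *)

Section NearIdentity.
Context {R : realType} {k : nat}.
Implicit Types (g h : SU R k) (c d : R).
Local Notation mx g := (@SU_mx R k g%g).

Lemma SU_mxM g h : mx (g * h) = mx g *m mx h. Proof. by []. Qed.

Lemma SU_mx1 : mx 1 = 1%:M. Proof. by []. Qed.

Definition near1 g c := opbound (mx g - 1%:M) c.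

Lemma near1_le {g c d} : c <= d -> near1 g c -> near1 g d.
Proof. exact: opbound_le. Qed.

Lemma near1_inv g c : near1 g c -> near1 g^-1%g c.
Proof.
move=> gc; rewrite /near1.
have -> : mx g^-1 - 1%:M = - (mx g^-1 *m (mx g - 1%:M)).
  by rewrite mulmxBr mulmx1 -SU_mxM mulVg opprB.
by apply/opboundN/opbound_unitaryl => //; exact: SU_unitary.
Qed.

Lemma near1_mul g h c d : near1 g c -> near1 h d -> near1 (g * h)%g (c + d).
Proof.
move=> gc hd; rewrite /near1.
have -> : mx (g * h) - 1%:M = (mx g - 1%:M) + mx g *m (mx h - 1%:M).
  by rewrite mulmxBr mulmx1 SU_mxM [RHS]addrC addrA subrK.
by apply: opboundD => //; apply: opbound_unitaryl => //; exact: SU_unitary.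
Qed.

Lemma near1_conj g h c : near1 g c -> near1 (h * g * h^-1)%g c.
Proof.
move=> gc; rewrite /near1.
have -> : mx (h * g * h^-1) - 1%:M = mx h *m (mx g - 1%:M) *m mx h^-1.
  by rewrite mulmxBr mulmxBl mulmx1 -!SU_mxM mulgV.
apply: opbound_unitaryr; first exact: SU_unitary.
by apply: opbound_unitaryl => //; exact: SU_unitary.
Qed.

(** Up to a unitary factor on the right, the difference is [g h - h g], which is also the additive
    commutator of [g - 1] and [h - 1]; hence the bound is a product of the two distances. *)
Lemma near1_comm g h c d : 0 <= c -> 0 <= d -> near1 g c -> near1 h d ->
  near1 (g * h * g^-1 * h^-1)%g (2 * c * d).
Proof.
move=> c0 d0 gc hd; rewrite /near1.
have -> : mx (g * h * g^-1 * h^-1) - 1%:M =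
   ((mx g - 1%:M) *m (mx h - 1%:M) - (mx h - 1%:M) *m (mx g - 1%:M)) *m
     mx (g^-1 * h^-1).
  have -> : (mx g - 1%:M) *m (mx h - 1%:M) - (mx h - 1%:M) *m (mx g - 1%:M) =
      mx (g * h) - mx (h * g).
    rewrite !(mulmxBl, mulmxBr) !mulmx1 !mul1mx -!SU_mxM.
    by apply/matrixP => i j; rewrite !mxE; ring.
  by rewrite mulmxBl -!SU_mxM !mulgA mulgK mulgV.
apply: opbound_unitaryr; first exact: SU_unitary.
apply: (@opbound_le _ _ _ (c * d + d * c)); first lra.
by apply: opboundD; [|apply: opboundN]; apply: opboundM.
Qed.

Lemma near1_pow_gap g c m n : (m <= n)%N ->
  opbound (mx (g ^+ n) - mx (g ^+ m)) c -> near1 (g ^+ (n - m))%g c.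
Proof.
move=> mn gc; rewrite /near1.
have -> : mx (g ^+ (n - m)) - 1%:M =
   mx (g ^+ m)^-1 *m (mx (g ^+ n) - mx (g ^+ m)).
  by rewrite mulmxBr -!SU_mxM mulVg -[in (g ^+ n)%g](subnKC mn) expgnDr mulKg.
by apply: opbound_unitaryl => //; exact: SU_unitary.
Qed.

End NearIdentity.

(** * Uniform recurrence of powers, by pigeonhole *)

Section Recurrence.
Context {R : realType} {k : nat}.
Local Notation mx g := (@SU_mx R k g%g).

(** Cuts [[-1, 1]] into pieces of length [1 / M]; the endpoint [1] gets the extra index [2 * M], so
    [inord] never falls back to its default on this interval. *)
Definition cell (M : nat) (x : R) : 'I_(2 * M).+1 :=
  inord (Num.truncn ((x + 1) * M%:R)).

Lemma cell_close (M : nat) (x y : R) : (0 < M)%N -> `|x| <= 1 -> `|y| <= 1 ->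
  cell M x = cell M y -> `|x - y| <= M%:R^-1.
Proof.
move=> M0; have M0' : 0 < M%:R :> R by rewrite ltr0n.
have cellE z : `|z| <= 1 ->
    (cell M z : nat)%:R <= (z + 1) * M%:R < (cell M z).+1%:R.
  rewrite ler_norml => /andP[z1 z2]; rewrite /cell.
  have z0 : 0 <= (z + 1) * M%:R by rewrite mulr_ge0//; lra.
  rewrite inordK ?truncn_itv// ltnS -(ler_nat R).
  apply: (@le_trans _ _ ((z + 1) * M%:R)); first by rewrite truncn_le.
  by rewrite natrM ler_wpM2r//; lra.
move=> /cellE/andP[x1 x2] /cellE/andP[y1 y2] xy.
rewrite xy -natr1 in x1 x2; rewrite -natr1 in y2.
rewrite -(ler_pM2r M0') mulVf ?gt_eqF// -[M%:R in leLHS]gtr0_norm// -normrM.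
by rewrite ler_norml; apply/andP; split; lra.
Qed.

Lemma SU_entry_le1 (g : SU R k) i j :
  `|complex.Re (mx g i j)| <= 1 /\ `|complex.Im (mx g i j)| <= 1.
Proof.
have : opbound (mx g) 1.
  by move=> v; rewrite mul1r l2norm_unitary ?SU_unitary.
move=> /(opbound_entry _ _ i j); rewrite expr1n => h.
have := sqr_ge0 (complex.Re (mx g i j)); have := sqr_ge0 (complex.Im (mx g i j)).
by split; rewrite -(@expr_le1 _ 2)// real_normK ?num_real//; lra.
Qed.

Lemma SU_power_near1 (e : R) : 0 < e -> exists N : nat, forall g : SU R k,
  exists2 m, (0 < m <= N)%N & near1 (g ^+ m)%g e.
Proof.
(* [M] is chosen so that [2 * M^-1 * k^2 <= e], the bound that [opbound_entries] gives for entries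
   closer than [M^-1]. *)
move=> e0; pose M := (Num.truncn (2 * k%:R ^+ 2 / e)).+1.
pose T := {ffun 'I_k * 'I_k -> 'I_(2 * M).+1 * 'I_(2 * M).+1}.
(* Among the powers [g^0, ..., g^N], with [N] the number of cell patterns, two share a pattern;
   their quotient is the required power. *)
exists #|{: T}| => g.
pose f (i : 'I_#|{: T}|.+1) : T := [ffun p =>
  (cell M (complex.Re (mx (g ^+ i) p.1 p.2)),
   cell M (complex.Im (mx (g ^+ i) p.1 p.2)))].
have /injectivePn[a [b ab fab]] : ~~ injectiveb f.
  by apply/negP => /injectiveP/leq_card; rewrite card_ord ltnn.
wlog {ab} ab : a b fab / (a < b)%N.
  move=> H; move: (ab); rewrite neq_ltn => /orP[|] lt_ab; first exact: (H a b).
  exact: (H b a).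
exists (b - a)%N; first by rewrite subn_gt0 ab (leq_trans (leq_subr _ _))// -ltnS.
apply: near1_pow_gap; first exact: ltnW.
have M0 : 0 < M%:R :> R by rewrite ltr0n.
apply: (@opbound_le _ _ _ (2 * M%:R^-1 * k%:R ^+ 2)).
  have : 2 * k%:R ^+ 2 / e < M%:R by exact: truncnS_gt.
  by rewrite ltr_pdivrMr// mulrAC ler_pdivrMr// [e * _]mulrC => /ltW.
apply: opbound_entries => [|i j]; first by rewrite invr_ge0 ltW.
have /ffunP/(_ (i, j)) := fab; rewrite !ffunE /= => -[re im].
have [rea ima] := SU_entry_le1 (g ^+ a)%g i j.
have [reb imb] := SU_entry_le1 (g ^+ b)%g i j.
have := cell_close M _ _ isT ima imb im; have := cell_close M _ _ isT rea reb re.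
rewrite !mxE; case: (mx (g ^+ a) i j) => ? ?; case: (mx (g ^+ b) i j) => ? ? /=.
by split; rewrite distrC.
Qed.

End Recurrence.

(** * Word maps are homomorphisms on the free group *)

Section WordMap.
Variables (G : groupType) (g h : G).
Local Open Scope group_scope.

Lemma eval_letter_inv x :
  eval_letter g h (letter_inv x) = (eval_letter g h x)^-1.
Proof. by case: x => -[] []; rewrite /eval_letter/= ?invgK. Qed.

Lemma prod_eval_push x s :
  \prod_(y <- push x s) eval_letter g h y =
  eval_letter g h x * \prod_(y <- s) eval_letter g h y.
Proof.
case: s => [|y s] /=; first by rewrite big_seq1 big_nil mulg1.
case: eqP => [->|_]; last by rewrite big_cons.
by rewrite big_cons eval_letter_inv mulVKg.
Qed.

Lemma word_mapM (u v : F2) :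
  word_map (u * v) g h = word_map u g h * word_map v g h.
Proof.
rewrite /word_map /=; elim: (u : seq letter) => /= [|x s IH].
  by rewrite big_nil mul1g.
by rewrite prod_eval_push IH big_cons mulgA.
Qed.

Lemma word_map1 : word_map 1 g h = 1.
Proof. by rewrite /word_map big_nil. Qed.

Lemma word_mapV (u : F2) : word_map u^-1 g h = (word_map u g h)^-1.
Proof. by apply: (mulIg (word_map u g h)); rewrite -word_mapM !mulVg word_map1. Qed.

Lemma word_mapX (u : F2) n : word_map (u ^+ n) g h = word_map u g h ^+ n.
Proof. by elim: n => [|n IH]; rewrite ?word_map1// !expgS word_mapM IH. Qed.

End WordMap.

(** * Lengths and outer letters of reduced words *)

Section FreeGroup.
Implicit Types (u v w : F2) (x y z : letter).
Local Open Scope group_scope.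

Lemma size_push x s : (size (push x s) <= (size s).+1)%N.
Proof. by case: s => //= y s; case: ifP => //= _; rewrite ltnW// ltnS. Qed.

Lemma word_lengthM u v :
  (word_length (u * v)%g <= word_length u + word_length v)%N.
Proof.
rewrite /word_length/=; elim: (u : seq letter) => //= x s IH.
by rewrite (leq_trans (size_push _ _)).
Qed.

Lemma word_lengthV u : word_length u^-1 = word_length u.
Proof. by rewrite /word_length/= /seq_inv size_rev size_map. Qed.

(** Serves to certify nontriviality: when the letters at the junction do not cancel, a product keeps
    its outer letters. *)
Definition ends x z w :=
  exists2 s, F2_word w = x :: s & last x s = z.

Lemma ends_neq1 x z w : ends x z w -> w <> 1.
Proof. by move=> [s ws _] w1; rewrite w1 in ws. Qed.

Lemma foldr_push_cat s t : reduced (s ++ t) -> foldr push t s = s ++ t.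
Proof.
elim: s => //= x s IH xst; rewrite IH; last exact: path_sorted xst.
by case: (s ++ t) xst => //= y r /andP[/negbTE ->].
Qed.

Lemma ends_mul {x y z t u v} : ends x y u -> ends z t v ->
  z != letter_inv y -> ends x t (u * v).
Proof.
move=> [s us sy] [r vr rt] zy.
exists (s ++ z :: r); last by rewrite last_cat.
rewrite /= us vr foldr_push_cat//= /reduced/= cat_path/= sy zy/=.
have := valP u; have := valP v; rewrite /= us vr /reduced/= => -> ->.
by [].
Qed.

Lemma ends_inv {x z w} : ends x z w -> ends (letter_inv z) (letter_inv x) w^-1.
Proof.
move=> [s ws sz].
have wE : (w^-1 : F2) = seq_inv (x :: s) :> seq letter by rewrite /= ws.
rewrite /seq_inv -sz in wE *; case/lastP: s => [|s z'] in ws sz wE *.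
  by exists [::].
rewrite last_rcons; rewrite map_cons map_rcons rev_cons rev_rcons /= in wE.
by eexists; [exact: wE|rewrite last_rcons].
Qed.

Definition letter_word x : F2 := @FreeWord [:: x] isT.

Lemma ends_letter x : ends x x (letter_word x).
Proof. by exists [::]. Qed.

Definition swap_letter x : letter := (~~ x.1, x.2).

Lemma swap_letter_inv x : swap_letter (letter_inv x) = letter_inv (swap_letter x).
Proof. by []. Qed.

Lemma swap_letterK : involutive swap_letter.
Proof. by case=> a b; rewrite /swap_letter/= negbK. Qed.

Lemma swap_reduced w : reduced (map swap_letter w).
Proof.
have := valP w; rewrite /reduced /= sorted_map; apply: sub_sorted => x y.
by rewrite /relpre /= -swap_letter_inv (inj_eq (inv_inj swap_letterK)).
Qed.

Definition swap w : F2 := FreeWord (swap_reduced w).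

Lemma ends_swap x z w : ends x z w -> ends (swap_letter x) (swap_letter z) (swap w).
Proof.
by move=> [s ws <-]; exists (map swap_letter s); rewrite /= ?ws// last_map.
Qed.

Lemma word_map_swap (G : groupType) (g h : G) w :
  word_map (swap w) g h = word_map w h g.
Proof.
rewrite /word_map big_map; apply: eq_bigr => -[a b] _.
by rewrite /eval_letter /=; case: a.
Qed.

End FreeGroup.

(** * From [near1] bounds to the topology, [L] and almost laws *)

Section SmallWords.
Local Open Scope classical_set_scope.
Local Open Scope ring_scope.
Context {R : realType} {k : nat}.
Local Notation mx g := (@SU_mx R k g%g).

(** The topology is induced from matrices, where a neighbourhood contains a product of entrywise
    ones; an operator bound controls each entry. *)
Lemma nbhs1_near1 (V : set (SU R k)) : nbhs (1%g : SU R k) V ->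
  exists2 e : R, 0 < e & forall g, near1 g e -> V g.
Proof.
rewrite nbhsE => -[B [Bo B1] BV]; case: Bo => C Co CB.
have : nbhs (mx 1) C by apply: open_nbhs_nbhs; split => //; move: B1; rewrite -CB.
move=> [P P1 PC].
have /filter_ex[e [e0 eP]] : \forall e \near (0 : R)^'+, 0 < e /\
    forall i j, ball (mx 1 i j) (e%:C)%C `<=` P i j.
  near=> e; split; first by near: e; exact: nbhs_right_gt.
  near: e; apply: filter_forall => i; apply: filter_forall => j.
  have /nbhs_ballP[d d0 dP] := P1 i j.
  (* Radii of balls in [R[i]] are themselves complex; positivity makes [d] real. *)
  have d'0 : 0 < complex.Re d by move: d0 => /=; rewrite ltcE/= => /andP[].
  near=> e => z ez; apply: dP; apply: le_ball ez.
  rewrite lecE/=; move: d0 => /=; rewrite ltcE/= => /andP[/eqP-> _]; rewrite eqxx/=.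
  by apply/ltW; near: e; exact: nbhs_right_lt.
(* Halving turns the weak inequality of [near1] into the strict one of a ball. *)
exists (e / 2); first by rewrite divr_gt0.
move=> g ge; apply: BV; rewrite -CB; apply: PC => i j; apply: eP.
rewrite -ball_normE/= -normrN opprB.
have E : (mx g - 1%:M) i j = mx g i j - mx 1 i j by rewrite SU_mx1 !mxE.
have := opbound_entry _ _ i j ge; rewrite -E; set z := (mx g - 1%:M) i j => ze.
suff : ((Num.sqrt (complex.Re z ^+ 2 + complex.Im z ^+ 2))%:C < e%:C)%C.
  by rewrite -normc_def.
rewrite ltcR -(@ltr_pXn2r _ 2) ?nnegrE ?sqrtr_ge0 ?(ltW e0)//.
by rewrite sqr_sqrtr ?addr_ge0 ?sqr_ge0//; nra.
Unshelve. all: by end_near. Qed.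

Lemma L_le (w : F2) (c : R) : 0 <= c ->
  (forall g h : SU R k, near1 (word_map w g h) c) -> L R k w <= c.
Proof.
move=> c0 wc; apply: ge_sup; first by apply/image_nonempty; exists (1%g, 1%g).
move=> _ [[g h] _ <-]; apply: opnorm_le => //=.
by rewrite -opprB; exact/opboundN/wc.
Qed.

Lemma almost_law_near1 (w : nat -> F2) (c : nat -> R) :
  (forall n, w n <> 1%g) ->
  (forall e, 0 < e -> exists m, forall n, (m <= n)%N -> c n <= e) ->
  (forall n (g h : SU R k), near1 (word_map (w n) g h) (c n)) ->
  almost_law (SU R k) w.
Proof.
move=> w1 c_to0 wc; split=> // V /nbhs1_near1[e e0 eV].
have [m cm] := c_to0 e e0; exists m => n mn g h.
by apply: eV; apply: opbound_le (wc n g h); exact: cm.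
Qed.

End SmallWords.

(** * Combining words without losing nontriviality *)

Section Words.
Local Open Scope group_scope.
Implicit Types (u v w : F2).

Definition la : F2 := letter_word (false, false).
Definition lb : F2 := letter_word (true, false).

(** If [u] and [v] begin and end with [a], conjugation by [b] shields them, so that [x] runs from
    [a] to [a^-1] and [y] from [a^-1] to [a]. No junction of the commutator then cancels, and it
    again begins and ends with [a]. Conjugation costs nothing in distance. *)
Definition conj_comm u v : F2 :=
  let x := la * (lb * u * lb^-1) * la^-1 in
  let y := la^-1 * (lb * v * lb^-1) * la^-1^-1 in
  x * y * x^-1 * y^-1.

Lemma ends_conj_comm u v :
  ends (false, false) (false, false) u -> ends (false, false) (false, false) v ->
  ends (false, false) (false, false) (conj_comm u v).
Proof.
pose a : letter := (false, false); pose b : letter := (true, false).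
pose A : letter := (false, true); pose B : letter := (true, true).
have ea : ends a a la by exact: ends_letter.
have eb : ends b b lb by exact: ends_letter.
have eA : ends A A la^-1 by exact: ends_inv ea.
have eB : ends B B lb^-1 by exact: ends_inv eb.
have eAA : ends a a la^-1^-1 by exact: ends_inv eA.
have ebc w : ends a a w -> ends b B (lb * w * lb^-1).
  by move=> ew; apply: ends_mul (ends_mul eb ew _) eB _.
move=> /ebc eu /ebc ev; rewrite /conj_comm.
set x := la * _ * _; set y := la^-1 * _ * _.
have ex : ends a A x by exact: ends_mul (ends_mul ea eu _) eA _.
have ey : ends A a y by exact: ends_mul (ends_mul eA ev _) eAA _.
have exV : ends a A x^-1 by exact: ends_inv ex.
have eyV : ends A a y^-1 by exact: ends_inv ey.
by exact: ends_mul (ends_mul (ends_mul ex ey _) exV _) eyV _.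
Qed.

(* The state is [(x_(n-1), x_n, u_n)]. *)
Definition step (t : F2 * F2 * F2) : F2 * F2 * F2 :=
  let: (y, x, u) := t in (x, x^-1 * (u * y^-1), u * y^-1).

(* [p], [q], [r] are the last letters of [x], [y] and the next [x]; they are
   permuted cyclically, and [f] stays the first letter of [u]. *)
Definition step_ends (t : F2 * F2 * F2) : Prop :=
  let: (y, x, u) := t in exists p q r f : letter,
    [/\ uniq [:: p; q; r], letter_inv f \notin [:: p; q; r],
        ends (letter_inv r) q y, ends (letter_inv q) p x & ends f p u].

(** In [u * y^-1] the letter [p] meets [letter_inv q], and in [x^-1 * (u * y^-1)] the letter [q]
    meets [f]; cancellation would force [p = q] or [q = letter_inv f]. The new triple is
    [(r, p, q)]. *)
Lemma step_endsP t : step_ends t -> step_ends (step t).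
Proof.
move: t => [[y x] u] [p [q [r [f []]]]] /= pqr fpqr ey ex eu.
have eyV := ends_inv ey; rewrite letter_invK in eyV.
have exV := ends_inv ex; rewrite letter_invK in exV.
have eu' : ends f r (u * y^-1).
  apply: (ends_mul eu eyV); rewrite (inj_eq (inv_inj letter_invK)) eq_sym.
  by move: pqr; rewrite /= inE negb_or -andbA => /and3P[].
exists r, p, q, f; split => //.
- move: pqr; rewrite /= !inE !negb_or !andbT => /andP[/andP[pq pr] qr].
  by rewrite eq_sym pr eq_sym qr.
- by move: fpqr; rewrite !inE !negb_or => /and3P[-> -> ->].
- apply: (ends_mul exV eu'); rewrite -[f in f != _]letter_invK.
  rewrite (inj_eq (inv_inj letter_invK)).
  by move: fpqr; rewrite !inE !negb_or => /and3P[].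
Qed.

(** The unequal bounds are stable under doubling [K]: the new [u] has length at most [K + K], the
    new [x] at most [2 K + K + K]. *)
Definition step_size (K : nat) (t : F2 * F2 * F2) : Prop :=
  let: (y, x, u) := t in
  [/\ word_length y <= K, word_length x <= K * 2 & word_length u <= K]%N.

Lemma step_sizeP K t : step_size K t -> step_size (K * 2)%N (step t).
Proof.
move: t => [[y x] u] [ly lx lu] /=.
have lu' := word_lengthM u y^-1; rewrite word_lengthV in lu'.
have lx' := word_lengthM x^-1 (u * y^-1); rewrite word_lengthV in lx'.
by split=> //; [apply: leq_trans lx' _|apply: leq_trans lu' _];
  rewrite muln2 -addnn leq_add// (leq_trans lu')// muln2 -addnn leq_add.
Qed.

End Words.

(** * A word uniformly close to the identity *)

Section SmallWordsSU.
Context {R : realType} {k : nat}.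
Implicit Types (g h : SU R k).

Lemma near1_2 g : near1 g 2.
Proof.
rewrite -[2%:R]natr1; apply: opboundD; last apply: opboundN.
  by move=> v; rewrite mul1r l2norm_unitary ?SU_unitary.
by move=> v; rewrite mul1mx mul1r.
Qed.

Lemma near1_conj_comm u v g h (c d : R) : 0 <= c -> 0 <= d ->
  near1 (word_map u g h) c -> near1 (word_map v g h) d ->
  near1 (word_map (conj_comm u v) g h) (2 * c * d).
Proof.
move=> c0 d0 uc vd; rewrite /conj_comm !(word_mapM, word_mapV).
apply: (near1_comm _ _ _ _ c0 d0); exact/near1_conj/near1_conj.
Qed.

Lemma word_map_la g h : word_map la g h = g.
Proof. by rewrite /word_map big_seq1. Qed.

(* The words [w] and [p] are merged into a commutator: the inner commutators
   square the small factor, which pays for the trivial bound [2] on the other. *)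
Lemma uniformly_small_word : exists2 w : F2,
  ends (false, false) (false, false) w &
  forall g h, near1 (word_map w g h) 8^-1.
Proof.
have [N NP] := @SU_power_near1 R k 8^-1 ltac:(lra).
(* The word may depend on [N] only, not on the exponent [m] that works for a given [g]; induction on
   [N] adds one exponent at a time. *)
suff [w ew wP] : exists2 w : F2, ends (false, false) (false, false) w &
    forall g h m, (0 < m <= N)%N -> near1 (g ^+ m)%g (8^-1 : R) ->
      near1 (word_map w g h) 8^-1.
  by exists w => // g h; have [m mN gm] := NP g; exact: wP mN gm.
elim: N {NP} => [|N [w ew wP]].
  exists la => [|g h m /andP[m0 m00]]; first exact: ends_letter.
  by exfalso; have := leq_trans m0 m00.
pose p := (la ^+ N.+1)%g.
have ep : ends (false, false) (false, false) p.
  rewrite /p; elim: (N) => [|n IH]; first by rewrite expg1; exact: ends_letter.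
  by rewrite expgS; exact: ends_mul (ends_letter _) IH _.
exists (conj_comm (conj_comm w w) (conj_comm p p)).
  by apply: ends_conj_comm; exact: ends_conj_comm.
have c8 : 0 <= 8^-1 :> R by lra.
(* The constant [1/8] reproduces itself: [2 * (1/8)^2 = 1/32], and the outer commutator with the
   trivial bound gives [2 * 2 * (1/32) = 1/8]. *)
have sq v g h : near1 (word_map v g h) (8^-1 : R) ->
    near1 (word_map (conj_comm v v) g h) (32^-1 : R).
  move=> vs; apply: (near1_le _ (near1_conj_comm _ _ _ _ _ _ c8 c8 vs vs)); lra.
move=> g h m /andP[m0]; rewrite leq_eqVlt => /orP[/eqP mN|mN] gm.
  have ps : near1 (word_map p g h) (8^-1 : R).
    by rewrite word_mapX word_map_la -mN.
  by apply: (near1_le _ (near1_conj_comm _ _ _ _ 2 32^-1 _ _ (near1_2 _)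
    (sq _ _ _ ps))); lra.
have ws : near1 (word_map w g h) (8^-1 : R) by apply: wP gm; rewrite m0.
by apply: (near1_le _ (near1_conj_comm _ _ _ _ 32^-1 2 _ _ (sq _ _ _ ws)
  (near1_2 _))); lra.
Qed.

End SmallWordsSU.

(* [144 / 89] is a Fibonacci quotient below the golden ratio, [169 / 70] a
   Pell quotient above [1 + sqrt 2]; [218 / 119] separates
   [ln (1 + sqrt 2) / ln phi] and [log2 (3 + sqrt 17) - 1]. *)
Section Exponent.
Context {R : realType}.

Definition phi : R := 144 / 89.

Lemma phi_gt1 : 1 < phi. Proof. by rewrite /phi; lra. Qed.

Lemma phi_gt0 : 0 < phi. Proof. exact: lt_trans phi_gt1. Qed.

Lemma phi_sqr : phi ^+ 2 <= phi + 1. Proof. by rewrite /phi; lra. Qed.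

(** Each step adds at least [phi - 1 = 55/89 > 1/2]. *)
Lemma half_le_phiX n : n%:R / 2 <= phi ^+ n.
Proof.
elim: n => [|n IH]; first by rewrite mul0r expr0.
have phi_n : 1 <= phi ^+ n by rewrite exprn_ege1// ltW// phi_gt1.
by rewrite exprSr -natr1 {2}/phi; lra.
Qed.

Lemma expR_phi_small (c e : R) : 0 < c -> 0 < e ->
  exists m, forall n, (m <= n)%N -> expR (- (c * phi ^+ n)) <= e.
Proof.
move=> c0 e0; exists (Num.truncn (2 / (c * e))).+1 => n mn.
have n_gt : 2 / (c * e) < n%:R by rewrite (lt_le_trans (truncnS_gt _))// ler_nat.
rewrite ltr_pdivrMr ?mulr_gt0// in n_gt.
rewrite expRN -[leLHS]mul1r ler_pdivrMr ?expR_gt0//.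
apply: (@le_trans _ _ (e * (1 + c * phi ^+ n))); last first.
  by rewrite ler_pM2l// expR_ge1Dx.
have : n%:R / 2 * (c * e) <= phi ^+ n * (c * e).
  by rewrite ler_wpM2r ?half_le_phiX// mulr_ge0 ?ltW.
lra.
Qed.

Lemma ler_frac_exp (a b c d m n : nat) : (0 < b)%N -> (0 < d)%N ->
  (a ^ m * d ^ n <= c ^ n * b ^ m)%N ->
  (a%:R / b%:R) ^+ m <= (c%:R / d%:R) ^+ n :> R.
Proof.
move=> b0 d0 abcd; rewrite !expr_div_n ler_pdivrMr ?exprn_gt0 ?ltr0n//.
rewrite mulrAC ler_pdivlMr ?exprn_gt0 ?ltr0n//.
by rewrite -!natrX -!natrM ler_nat.
Qed.

Lemma pell_le_fib : (169 / 70) ^+ 119 <= phi ^+ 218.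
Proof.
have h : (169 ^ 119 * 89 ^ 218 <= 144 ^ 218 * 70 ^ 119)%N by lia.
rewrite /phi; exact: (ler_frac_exp 169 70 144 89 _ _ isT isT h).
Qed.

(** Here [235/66 = (3 + 136/33) / 2], where [136/33] is a lower bound for the square root of 17. *)
Lemma two_le_sqrt17 : (2 / 1) ^+ 218 <= (235 / 66) ^+ 119 :> R.
Proof.
have h : (2 ^ 218 * 66 ^ 119 <= 235 ^ 119 * 1 ^ 218)%N by lia.
exact: (ler_frac_exp 2 1 235 66 _ _ isT isT h).
Qed.

Lemma sqrt2_lt : 1 + Num.sqrt 2 <= 169 / 70 :> R.
Proof.
suff : Num.sqrt 2 <= 99 / 70 :> R by lra.
by rewrite -(@ler_pXn2r _ 2) ?nnegrE ?sqrtr_ge0 ?sqr_sqrtr//; lra.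
Qed.

Lemma sqrt17_ge : 136 / 33 <= Num.sqrt 17 :> R.
Proof.
by rewrite -(@ler_pXn2r _ 2) ?nnegrE ?sqrtr_ge0 ?sqr_sqrtr//; lra.
Qed.

Lemma ln2_gt0 : 0 < ln 2 :> R. Proof. by rewrite ln_gt0// ltr1n. Qed.

Lemma delta_num_le : ln (1 + Num.sqrt 2) *+ 119 <= ln phi *+ 218.
Proof.
have p0 := @phi_gt0.
have e0 : 0 < 1 + Num.sqrt 2 :> R by rewrite ltr_pwDl// sqrtr_ge0.
rewrite -!lnXn// ler_ln ?posrE ?exprn_gt0//.
apply: le_trans pell_le_fib; rewrite lerXn2r ?nnegrE ?sqrt2_lt ?ltW//.
Qed.

Lemma delta_den_ge : ln 2 *+ 218 <= (ln (3 + Num.sqrt 17) - ln 2) *+ 119 :> R.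
Proof.
have s17 := sqrt17_ge.
have e1 : 0 < 3 + Num.sqrt 17 :> R by lra.
have e0 : 0 < (3 + Num.sqrt 17) / 2 :> R by rewrite divr_gt0.
rewrite -ln_div ?posrE//.
rewrite -!lnXn// ler_ln ?posrE ?exprn_gt0//.
rewrite -[2 in leLHS]divr1; apply: le_trans two_le_sqrt17 _.
rewrite lerXn2r ?nnegrE//; lra.
Qed.

(** This says that [delta] is at most [log2 phi]. In logarithms, [delta = x / (y - ln 2)], and [x *
    ln 2 <= (218/119) * ln phi * ln 2 <= ln phi * (y - ln 2)]. *)
Lemma delta_ge0_two_powR : 0 <= delta R /\ 2 `^ delta R <= phi.
Proof.
have l2 := ln2_gt0; have num := delta_num_le; have den := delta_den_ge.
have num0 : 0 < ln (1 + Num.sqrt 2) :> R.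
  by rewrite ln_gt0// ltrDl sqrtr_gt0 ltr0n.
set x := ln (1 + _) in num num0; set y := ln (3 + _) in den.
have den0 : 0 < y - ln 2.
  by rewrite -(pmulrn_lgt0 _ (isT : (0 < 119)%N)) (lt_le_trans _ den)// mulrn_wgt0.
have dE : delta R = x / (y - ln 2).
  rewrite /delta /log2 -/x -/y; field; rewrite !gt_eqF//.
rewrite dE; split; first by rewrite divr_ge0 ?ltW.
rewrite -ler_ln ?posrE ?phi_gt0 ?powR_gt0// ln_powR mulrAC ler_pdivrMr//.
rewrite -[_ *+ 218]mulr_natr -[_ *+ 119]mulr_natr in num.
rewrite -[_ *+ 218]mulr_natr -[_ *+ 119]mulr_natr in den.
have lphi : 0 < ln phi by nra.
nra.
Qed.

End Exponent.

(** * Decay along the recursion and its starting point *)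

Section Iteration.
Context {R : realType} {k : nat}.

(** The factor [1/2] absorbs the constant of the commutator bound, so that the exponents simply
    add. *)
Definition step_near (s t : R) (w : F2 * F2 * F2) : Prop :=
  let: (y, x, u) := w in
  [/\ x = (y^-1 * u)%g,
      forall g h : SU R k, near1 (word_map y g h) (expR (- s) / 2) &
      forall g h : SU R k, near1 (word_map x g h) (expR (- t) / 2)].

Lemma step_nearP (s t r : R) w : r <= s + t ->
  step_near s t w -> step_near t r (step w).
Proof.
move: w => [[y x] u] rst [xE ys xt] /=; split=> // g h.
(* Since [u = y * x], the shortened product is the commutator of [x^-1] and [y]. *)
have -> : (x^-1 * (u * y^-1) = x^-1 * y * x^-1^-1 * y^-1)%g.
  by rewrite xE !invgK !mulgA mulgK.
rewrite !(word_mapM, word_mapV).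
have eR z : 0 <= expR z / 2 :> R by rewrite divr_ge0 ?expR_ge0.
apply: near1_le (near1_comm _ _ _ _ (eR _) (eR _) (near1_inv _ _ (xt g h)) (ys g h)).
have : expR (- t) * expR (- s) <= expR (- r) :> R.
  by rewrite -expRD ler_expR; lra.
lra.
Qed.

Lemma initial_words : exists2 c : R, 0 < c &
  exists2 w, step_ends w & step_near c (c * phi) w.
Proof.
have [w ew ws] := @uniformly_small_word R k.
have es := ends_swap _ _ _ ew; have ewV := ends_inv ew.
have l2 := @ln2_gt0 R; have p0 := @phi_gt0 R.
(* Then [c * phi = ln 2], and the bound required of the second word is [1/4 = 1/8 + 1/8]. *)
exists (ln 2 / phi); first by rewrite divr_gt0.
rewrite divfK ?gt_eqF//; exists (w, (w^-1 * swap w)%g, swap w).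
  (* These are [p = b], [q = a], [r = a^-1] and [f = b]. *)
  exists (true, false), (false, false), (false, true), (true, false).
  by split => //; exact: ends_mul ewV es _.
have e2 : expR (- ln 2) = 2^-1 :> R by rewrite expRN lnK// posrE.
split => // g h; last first.
  rewrite word_mapM word_mapV word_map_swap.
  have wV := near1_inv _ _ (ws g h).
  by apply: near1_le (near1_mul _ _ _ _ wV (ws h g)); rewrite e2; lra.
apply: near1_le (ws g h).
have : expR (- ln 2) <= expR (- (ln 2 / phi)) :> R.
  rewrite ler_expR lerN2 ler_pdivrMr// ler_peMr// ?ltW//; rewrite /phi; lra.
by rewrite e2; lra.
Qed.

End Iteration.

Theorem theorem5p2 (R : realType) (k : nat) (hk : (1 <= k)%N) :
  exists2 w : nat -> F2,
    almost_law (SU R k) w &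
    exists2 C : R, 0 < C &
      forall n : nat,
        L R k (w n) <= expR (- (C * (word_length (w n))%:R `^ delta R)).
Proof.
have [c c0 [w0 e0 n0]] := @initial_words R k.
have p0 := @phi_gt0 R.
pose wt n := iter n step w0; pose w n := (wt n).1.1.
have wt_ends n : step_ends (wt n) by elim: n => //= n; exact: step_endsP.
(* The successor keeps [K] positive, as the division by its power below requires. *)
pose K := (word_length w0.1.1 + word_length w0.1.2 + word_length w0.2).+1.
have wt_size n : step_size (K * 2 ^ n)%N (wt n).
  elim: n => [|n IH]; last by rewrite expnSr mulnA; exact: step_sizeP.
  by rewrite /K /wt /=; case: (w0) => [[y x] u] /=; split; lia.
have wt_near n : step_near (k := k) (c * phi ^+ n) (c * phi ^+ n.+1) (wt n).
  elim: n => [|n IH]; first by rewrite expr0 mulr1 expr1.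
  (* What remains is [phi^(n+2) <= phi^n + phi^(n+1)], which holds because [phi] lies below the
     golden ratio. *)
  apply: step_nearP IH; rewrite -mulrDr ler_wpM2l ?(ltW c0)//.
  have := ler_wpM2l (exprn_ge0 n (ltW p0)) (@phi_sqr R).
  by rewrite mulrDr mulr1 -exprD addn2 -exprSr addrC.
have w_near n (g h : SU R k) : near1 (word_map (w n) g h) (expR (- (c * phi ^+ n))).
  have := wt_near n; rewrite /w; case: (wt n) => [[y x] u] [_ + _] => /(_ g h).
  by apply: near1_le; rewrite ler_pdivrMr// ler_peMr ?expR_ge0// ler1n.
exists w.
  apply: almost_law_near1 w_near => [n|e e_gt0].
    have := wt_ends n; rewrite /w; case: (wt n) => [[y x] u] [p [q [r [f []]]]] _ _.
    by move=> /ends_neq1.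
  exact: expR_phi_small.
have [d0 dphi] := @delta_ge0_two_powR R.
have K0 : 0 < K%:R `^ delta R :> R by rewrite powR_gt0// ltr0n.
(* This constant compensates [(K * 2^n)^delta = K^delta * (2^delta)^n <= K^delta * phi^n]. *)
exists (c / K%:R `^ delta R); first by rewrite divr_gt0.
move=> n.
apply: le_trans (L_le _ _ (expR_ge0 _) (w_near n)) _.
rewrite ler_expR lerN2 mulrAC ler_pdivrMr// -mulrA ler_wpM2l ?(ltW c0)//.
have sz : (word_length (w n) <= K * 2 ^ n)%N.
  by have := wt_size n; rewrite /w; case: (wt n) => [[y x] u] [].
apply: (@le_trans _ _ ((K * 2 ^ n)%:R `^ delta R)).
  by apply: ge0_ler_powR; rewrite ?nnegrE ?ler_nat.
rewrite natrM powRM// mulrC ler_wpM2r ?(ltW K0)// natrX.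
rewrite -powR_mulrn// -powRrM mulrC powRrM powR_mulrn ?powR_ge0//.
by rewrite lerXn2r ?nnegrE ?powR_ge0 ?(ltW p0).
Qed.
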